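(* Let $G$ be a finite group with exactly $n$ distinct centralizers, where $n\le 21$, i.e. $|\mathcal{C}(G)|=n\le 21$. Then $G$ is soluble. Moreover, the alternating group $A_5$ of degree $5$ satisfies $|\mathcal{C}(A_5)|=22$, so the bound $21$ cannot be increased.
   Context: For a group $G$, $\mathcal{C}(G)=\{C_G(x) : x\in G\}$ denotes the set of centralizers of elements of $G$, where $C_G(x)=\{g\in G: gx=xg\}$. A group $G$ is called a $\mathcal{C}_n$-group if $|\mathcal{C}(G)|=n$. *)

(* Defs.v *)
From mathcomp Require Import all_boot all_fingroup all_solvable.
Set Implicit Arguments. Unset Strict Implicit. Unset Printing Implicit Defensive.
Local Open Scope group_scope.

Definition centralizers (gT : finGroupType) (G : {set gT}) : {set {set gT}} :=
  [set 'C_G[x] | x in G].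

(* Main.v *)
Require Import Defs.
From mathcomp Require Import all_boot all_fingroup all_solvable.
From mathcomp Require Import integral_char zify.
From mathcomp Require ssralg finalg.
Set Implicit Arguments. Unset Strict Implicit. Unset Printing Implicit Defensive.
Local Open Scope group_scope.

(* Pairwise noncommuting elements have distinct centralizers, different from G,
   so G has no 21 pairwise noncommuting elements; unlike the number of
   centralizers, this passes to quotients, which reduces to G simple nonabelian.
   The centralizers of a maximal noncommuting set cover G, hence some
   nontrivial class K has fewer than 20 < 5^2 elements.  For a prime p >= 5, a
   Sylow p-subgroup P acts on K with orbits of size 1 or p and so contains an
   element lying in no other Sylow p-subgroup.  Choosing one such element in
   each gives a noncommuting set, so there are at most 20 Sylow p-subgroups.
   In the few remaining cases noncommuting elements of different orders are
   put together.  For 5 dividing |G|, say, one has either 6 Sylow 5-subgroups,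
   at least 10 Sylow 3-subgroups and 5 conjugates under P of a 2-element
   normalizing but not centralizing P (Burnside transfer), or 16 and 5 instead,
   always at least 21 elements.  So |G| is divisible by 2 and 3 only, and
   Burnside's p^a q^b theorem concludes. *)

(** * Noncommuting sets, their relation to centralizers, and small conjugacy classes *)

Section Noncommuting.

Definition noncommuting (gT : finGroupType) (A : {set gT}) :=
  [forall x in A, forall y in A, (x * y == y * x) ==> (x == y)].

Variable gT : finGroupType.
Implicit Types (A B : {set gT}) (G H : {group gT}).

Lemma noncommutingP A :
  reflect {in A &, forall x y, commute x y -> x = y} (noncommuting A).
Proof.
apply: (iffP forall_inP) => [ncA x y Ax Ay cxy | ncA x Ax].
  by apply/eqP; move/forall_inP: (ncA x Ax) => /(_ y Ay)/implyP; apply; apply/eqP.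
by apply/forall_inP=> y Ay; apply/implyP=> /eqP cxy; rewrite (ncA x y).
Qed.

Definition cross_noncommuting A B := {in A & B, forall x y, ~ commute x y}.

Lemma noncommutingU A B :
    noncommuting A -> noncommuting B -> cross_noncommuting A B ->
  noncommuting (A :|: B) /\ #|A :|: B| = (#|A| + #|B|)%N.
Proof.
move=> /noncommutingP ncA /noncommutingP ncB ncAB; split; last first.
  rewrite cardsU (_ : A :&: B = set0) ?cards0 ?subn0 //.
  by apply/eqP/set0Pn=> [[x /setIP[Ax Bx]]]; apply: (ncAB x x).
apply/noncommutingP=> x y /setUP[] Ux /setUP[] Uy cxy; auto.
  by case: (ncAB x y).
by case: (ncAB y x) => //; apply: commute_sym.
Qed.

Lemma noncommuting_imset (I : finType) (S : {set I}) (f : I -> gT) :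
    {in S &, forall i j, commute (f i) (f j) -> i = j} ->
  noncommuting (f @: S) /\ #|f @: S| = #|S|.
Proof.
move=> ncf; split; last first.
  by apply: card_in_imset => i j Si Sj eqf; apply: ncf; rewrite // eqf.
by apply/noncommutingP=> _ _ /imsetP[i Si ->] /imsetP[j Sj ->] /ncf->.
Qed.

Definition noncommuting_le n G :=
  forall A, A \subset G -> noncommuting A -> #|A| <= n.

Lemma noncommuting_leS n G H :
  H \subset G -> noncommuting_le n G -> noncommuting_le n H.
Proof. by move=> sHG leG A sAH; apply: leG; apply: subset_trans sHG. Qed.

(** Elements of a noncommuting set have distinct centralizers, as each lies in its own. A set with
    two or more elements contains no central element, so ['C_G[1]], which is [G], is one more
    centralizer; this saves one in the bound. *)
Lemma centralizers_noncommuting_le n G :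
  0 < n -> #|centralizers G| <= n.+1 -> noncommuting_le n G.
Proof.
move=> n_gt0 leCn A sAG /noncommutingP ncA.
have [A_le1 | A_gt1] := leqP #|A| 1; first exact: leq_trans n_gt0.
have injC: {in A &, injective (fun x => 'C_G[x])}.
  move=> x y Ax Ay eqC; apply: ncA => //; apply/cent1P.
  have: x \in 'C_G[x] by rewrite inE cent1id (subsetP sAG).
  by rewrite eqC => /setIP[].
rewrite -ltnS (leq_trans _ leCn) // -(card_in_imset injC).
have memC x: x \in G -> 'C_G[x] \in centralizers G by move=> Gx; apply: imset_f.
rewrite (cardsD1 'C_G[1] (centralizers G)) memC ?group1 // ltnS.
apply/subset_leq_card/subsetP=> _ /imsetP[x Ax ->].
rewrite in_setD1 memC ?(subsetP sAG) // andbT.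
apply: contraTneq A_gt1 => eqC; rewrite -leqNgt.
rewrite cent11T setIT in eqC; rewrite -(cards1 x) subset_leq_card //.
apply/subsetP=> y Ay; apply/set1P/ncA=> //; apply/cent1P.
by move: (subsetP sAG y Ay); rewrite -eqC => /setIP[].
Qed.

(** Take [A] maximal for inclusion: an [x] commuting with no element of [A] could be added to it. *)
Lemma noncommuting_maximal_cover (S : {set gT}) :
  {A : {set gT} | [/\ A \subset S, noncommuting A
     & {in S, forall x, exists2 a, a \in A & commute x a}]}.
Proof.
pose ok (A : {set gT}) := (A \subset S) && noncommuting A.
have ok0 : ok set0.
  by rewrite /ok sub0set; apply/noncommutingP=> x y; rewrite inE.
have [A /maxsetP[/andP[sAS ncA] maxA] _] := maxset_exists ok0.
exists A; split=> // x Sx.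
have [/exists_inP[a Aa /eqP cxa]|] := boolP [exists a in A, x * a == a * x].
  by exists a.
rewrite negb_exists_in => /forall_inP ncx; exists x => //.
rewrite -(maxA (x |: A)) ?setU11 ?subsetUr // /ok subUset sub1set Sx sAS /=.
have [] // := @noncommutingU [set x] A.
  by apply/noncommutingP=> y z /set1P-> /set1P->.
by move=> y a /set1P-> Aa cya; case/eqP: (ncx a Aa).
Qed.

End Noncommuting.

(** Coset representatives that commute have commuting cosets, so a noncommuting set lifts to one of
    the same size. *)
Lemma noncommuting_le_quotient (gT : finGroupType) n (G N : {group gT}) :
  N <| G -> noncommuting_le n G -> noncommuting_le n (G / N).
Proof.
move=> nsNG leG A sAG /noncommutingP ncA.
have [] := @noncommuting_imset _ _ A (fun x => repr x).
  move=> x y Ax Ay cxy; apply: ncA => //.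
  by rewrite /commute -[x]coset_reprK -[y]coset_reprK -!morphM ?repr_coset_norm ?cxy.
move=> ncR <-; apply: leG ncR; apply/subsetP=> _ /imsetP[x Ax ->].
have /morphimP[y nNy Gy def_x] := subsetP sAG x Ax.
have: repr x \in N :* y by rewrite -val_coset // -def_x mem_repr_coset.
by case/rcosetP=> z Nz ->; rewrite groupM // (subsetP (normal_sub nsNG)).
Qed.

(** If all classes of elements of a maximal noncommuting set had at least [n] elements, each
    centralizer would contain at most [#|G| / n - 1] nontrivial elements. At most [n] of them would
    then cover at most [#|G| - n] elements, too few for [G^#]. *)
Lemma noncommuting_le_small_class (gT : finGroupType) (G : {group gT}) n :
    1 < n -> ~~ abelian G -> noncommuting_le n G ->
  exists2 x, x \in G^# & #|x ^: G| < n.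
Proof.
move=> n_gt1 ncGG leG; have [A [sAG ncA covA]] := noncommuting_maximal_cover G^#.
have [/exists_inP[x Ax ltx]|] := boolP [exists a in A, #|a ^: G| < n].
  by exists x; rewrite ?(subsetP sAG).
rewrite negb_exists_in => /forall_inP geA; exfalso.
have leA: #|A| <= n by apply: leG => //; apply: subset_trans sAG (subsetDl _ _).
have covG: G^# \subset \bigcup_(a in A) 'C_G[a]^#.
  apply/subsetP=> x G1x; have [a Aa cxa] := covA x G1x.
  apply/bigcupP; exists a => //; move: G1x; rewrite !in_setD1 in_setI => /andP[-> ->] /=.
  exact/cent1P.
have leC a: a \in A -> #|'C_G[a]^#| * n <= #|G| - n.
  move=> Aa; have := geA a Aa; rewrite -leqNgt -index_cent1 => le_n.
  have := Lagrange (subsetIl G 'C[a]); rewrite (cardsD1 1 'C_G[a]) group1.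
  rewrite add1n => <-; have := leq_mul (leqnn #|'C_G[a]^#|.+1) le_n.
  by rewrite mulSn => le_m; rewrite -(leq_add2r n) subnK ?(leq_trans _ le_m) ?leq_addr // addnC.
have oG: #|G| = #|G^#|.+1 by rewrite (cardsD1 1 G) group1.
have leU: #|G^#| <= \sum_(a in A) #|'C_G[a]^#|.
  apply: leq_trans (subset_leq_card covG) _.
  elim/big_rec2: _ => [|a m B _ le_Bm]; first by rewrite cards0.
  by rewrite (leq_trans (leq_card_setU _ _)) ?leq_add2l.
have: #|G^#| * n <= #|A| * (#|G| - n).
  apply: leq_trans (leq_mul leU (leqnn n)) _.
  by rewrite big_distrl -sum_nat_const leq_sum.
(* This settles the case [#|G| < n], where the truncated difference [#|G| - n] is 0. *)
have: 1 < #|G|.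
  by rewrite ltnNge -trivg_card_le1; apply: contra ncGG => /eqP->; apply: abelian1.
nia.
Qed.

(** * Actions of p-groups on fewer than p^2 points *)

Section SmallAction.

Variables (aT : finGroupType) (sT : finType) (to : {action aT &-> sT}).
Variables (p : nat) (S : {set sT}).
Hypothesis (small_S : #|S| < p ^ 2).
Implicit Types (P R : {group aT}).

Lemma small_action_orbit P x :
    p.-group P -> [acts P, on S | to] -> x \in S -> x \notin 'Fix_to(P) ->
  #|orbit to P x| = p.
Proof.
move=> pP actP Sx nfx.
have [k ok] : {k | #|orbit to P x| = (p ^ k)%N}.
  by apply: p_natP; apply: pnat_dvd pP; apply: dvdn_orbit.
have sOS: orbit to P x \subset S by rewrite acts_sub_orbit.
case: k ok => [/card_orbit1 o1 | [|k] ok]; last 2 first.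
- by rewrite ok expn1.
- have := leq_ltn_trans (subset_leq_card sOS) small_S.
  rewrite ok ltnNge -[(k.+2)]addn2 expnD leq_pmull // expn_gt0.
  case: (posnP p) small_S => // ->; by rewrite ltn0.
by case/orbit1P: nfx.
Qed.

(** The stabilizer of a moved point has index [p] in the p-group [P], hence is normal and equal to
    the stabilizers of all points in the orbit. *)
Lemma small_action_stab P x y :
    p.-group P -> [acts P, on S | to] -> x \in S -> y \in orbit to P x ->
  'C_P[x | to] \subset 'C[y | to].
Proof.
move=> pP actP Sx /orbitP[a Pa <-{y}].
have [fx | nfx] := boolP (x \in 'Fix_to(P)).
  by rewrite (afixP fx) // subsetIr.
have ox := small_action_orbit pP actP Sx nfx.
have p_pr : prime p.
  by have := pgroup_pdiv pP; case: eqP => [P1|_ []//]; rewrite P1 afix1 inE in nfx.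
have nsC: 'C_P[x | to] <| P.
  apply: p_maximal_normal pP _; apply: p_index_maximal; first exact: subsetIl.
  by rewrite -card_orbit ox.
by rewrite astab1_act -(normsP (normal_norm nsC) a Pa) conjSg subsetIr.
Qed.

(** The points moved by [P] form [m < p] orbits of size [p]. If every element of [P] fixed one of
    these points it would fix a whole orbit, that is at least [p] points, whereas by orbit counting
    the average number of fixed points is [m]. *)
Lemma small_action_regular P :
    p.-group P -> [acts P, on S | to] ->
  exists2 z, z \in P & 'Fix_(S | to)[z] = 'Fix_(S | to)(P).
Proof.
move=> pP actP; pose S' := S :\: 'Fix_to(P).
have actP': [acts P, on S' | to] by rewrite actsD ?acts_fix_norm ?normG.
have [/exists_inP[z Pz /eqP f0] | ] :=
  boolP [exists z in P, 'Fix_(S' | to)[z] == set0].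
  exists z => //; apply/eqP; rewrite eqEsubset andbC setIS ?afixS ?sub1set //=.
  apply/subsetP=> x /setIP[Sx fx]; rewrite inE Sx /=; apply: contraT => nfx.
  by have /setP/(_ x) := f0; rewrite in_set0 inE in_setD Sx nfx fx.
rewrite negb_exists_in => /forall_inP nf; exfalso.
have oS': {in orbit to P @: S', forall O : {set sT}, #|O| = p}.
  by move=> _ /imsetP[x /setDP[Sx nfx] ->]; apply: small_action_orbit.
have := card_uniform_partition oS' (orbit_partition actP').
move=> defS'; have := Frobenius_Cauchy actP'; set m := #|_ @: _| in defS' *.
have lt_m : m < p.
  have: m * p < p * p by rewrite -defS' mulnn (leq_ltn_trans _ small_S) ?subset_leq_card ?subsetDl.
  by rewrite ltn_mul2r => /andP[].
suffices: p * #|P| <= \sum_(a in P) #|'Fix_(S' | to)[a]|.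
  by move=> le_p sumP; move: le_p; rewrite sumP leq_pmul2r ?cardG_gt0 // leqNgt lt_m.
rewrite mulnC -sum_nat_const leq_sum // => a Pa.
have /set0Pn[x /setIP[S'x fx]] := nf a Pa.
have [Sx nfx] := setDP S'x.
rewrite -(small_action_orbit pP actP Sx nfx) subset_leq_card //.
apply/subsetP=> y Oy; rewrite inE (subsetP _ y Oy) ?acts_sub_orbit //=.
apply/afix1P/astab1P/(subsetP (small_action_stab pP actP Sx Oy)).
by rewrite inE Pa; apply/astab1P/afix1P.
Qed.

(* On every [<[z]>]-orbit both groups act as powers of [z]; elsewhere [P] acts trivially. *)
Lemma small_action_commute P R z :
    p.-group P -> [acts P, on S | to] -> p.-group R -> [acts R, on S | to] ->
    z \in P -> z \in R -> 'Fix_(S | to)[z] = 'Fix_(S | to)(P) ->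
  {in S & P & R, forall x a b, to (to x a) b = to (to x b) a}.
Proof.
move=> pP actP pR actR Pz Rz fixz x a b Sx Pa Rb.
have [fx | nfx] := boolP (x \in 'Fix_to[z]).
  have fP y: y \in S -> y \in 'Fix_to[z] -> to y a = y.
    move=> Sy fy; have: y \in 'Fix_(S | to)(P) by rewrite -fixz inE Sy.
    by case/setIP=> _ /afixP->.
  rewrite !fP ?(actsP actR) //; apply: contraT => nfxb.
  have ntR: x \notin 'Fix_to(R).
    by apply: contra nfxb => /afixP->.
  (* Since [z] fixes [x], it fixes the whole [R]-orbit of [x], and [to x b] in particular. *)
  have := small_action_stab pR actR Sx (mem_orbit to x Rb).
  move/subsetP/(_ z); rewrite inE Rz => /(_ _)/astab1P zfix.
  by case/afix1P: nfxb; apply: zfix; apply/astab1P/afix1P.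
have orbz (Q : {group aT}): p.-group Q -> [acts Q, on S | to] -> z \in Q ->
    {in Q, forall c, exists i, {in orbit to <[z]> x, forall y, to y c = to y (z ^+ i)}}.
  move=> pQ actQ Qz c Qc; have nfQ: x \notin 'Fix_to(Q).
    by apply: contra nfx => /afixP fx; apply/afix1P/fx.
  have szQ: <[z]> \subset Q by rewrite cycle_subG.
  have nfz: x \notin 'Fix_to(<[z]>) by rewrite afix_cycle.
  have actz := subset_trans szQ actQ.
  (* Both orbits have [p] elements. So [c] agrees at [x] with a power of [z], and then on the whole
     orbit, where stabilizers are constant. *)
  have eqO: orbit to <[z]> x = orbit to Q x.
    apply/eqP; rewrite eqEcard imsetS //=.
    by rewrite !small_action_orbit // (pgroupS szQ).
  have: to x c \in orbit to <[z]> x by rewrite eqO mem_orbit.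
  case/orbitP=> _ /cycleP[i ->] def_xc; exists i => y; rewrite eqO => Oy.
  have: c * z ^- i \in 'C_Q[x | to].
    by rewrite inE groupM ?groupV ?groupX //=; apply/astab1P; rewrite actM -def_xc actK.
  move/(subsetP (small_action_stab pQ actQ Sx Oy))/astab1P.
  by rewrite actM => /(canRL (actKV _ _)).
have [i eqa] := orbz P pP actP Pz a Pa; have [j eqb] := orbz R pR actR Rz b Rb.
have Oxz k: to x (z ^+ k) \in orbit to <[z]> x by rewrite mem_orbit ?mem_cycle.
have Ox: x \in orbit to <[z]> x by apply: orbit_refl.
by rewrite eqa // eqb // eqb // eqa // -!actM -!expgD addnC.
Qed.

Lemma small_action_cent P R z :
    p.-group P -> [acts P, on S | to] -> p.-group R -> [acts R, on S | to] ->
    z \in P -> z \in R -> 'Fix_(S | to)[z] = 'Fix_(S | to)(P) ->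
    'C_(P <*> R)(S | to) = 1 -> R \subset 'C(P).
Proof.
move=> pP actP pR actR Pz Rz fixz faith.
have comm := small_action_commute pP actP pR actR Pz Rz fixz.
apply/centsP=> b Rb a Pa; apply/commgP/eqP.
suffices: [~ b, a] \in 'C_(P <*> R)(S | to) by rewrite faith => /set1gP.
rewrite in_setI groupR ?mem_gen ?in_setU ?Pa ?Rb ?orbT //=.
apply/astabP=> x Sx; have Sxb: to x b^-1 \in S by rewrite (actsP actR) ?groupV.
by rewrite commgEl /conjg !actM (comm _ a^-1 b) ?groupV // !actKV.
Qed.

End SmallAction.

(** * Burnside's transfer theorem for an abelian Sylow subgroup central in its normalizer *)

Section BurnsideTransfer.

Variables (gT : finGroupType) (p : nat) (G P : {group gT}).
Hypotheses (sylP : p.-Sylow(G) P) (abelP : abelian P).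
Hypothesis (cNP : 'N_G(P) \subset 'C(P)).

(** Both [P] and [P :^ y] are Sylow subgroups of ['C_G[h ^ y]], so some [c] there brings [P :^ y]
    back to [P]. Then [y * c] normalizes [P] and therefore centralizes [h]. *)
Lemma Burnside_fusion h y : h \in P -> y \in G -> h ^ y \in P -> h ^ y = h.
Proof.
move=> Ph Gy Phy; have sPG := pHall_sub sylP.
have sylC (R : {group gT}): p.-Sylow(G) R -> abelian R -> h ^ y \in R -> p.-Sylow('C_G[h ^ y]) R.
  move=> sylR abelR Rhy; apply: (pHall_subl _ (subsetIl _ _) sylR).
  by rewrite subsetI (pHall_sub sylR) sub_cent1 (subsetP abelR).
have sylPy: p.-Sylow('C_G[h ^ y]) (P :^ y)%G.
  by apply: sylC; rewrite /= ?pHallJ ?abelianJ ?memJ_conjg.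
have [c /setIP[Gc cc] defP] := Sylow_trans sylPy (sylC _ sylP abelP Phy).
have: y * c \in 'N_G(P) by rewrite inE groupM //= inE conjsgM -defP.
move/(subsetP cNP)/centP/(_ h Ph) => cyc.
have: h ^ (y * c) = h by apply/conjg_fixP/commgP/commute_sym.
by rewrite conjgM (conjg_fixP _) //; apply/commgP/commute_sym/cent1P.
Qed.

(** [N] is the kernel of the transfer from [G] to [P]. By [Burnside_fusion] the conjugations in the
    transfer formula disappear on [P], leaving the power map with exponent [#|G : P|], which is
    injective because this index is prime to [p]. *)
Lemma Burnside_transfer_ker :
  exists2 N : {group gT}, N <| G & abelian (G / N) /\ N :&: P = 1.
Proof.
have sPG := pHall_sub sylP.
have abA: abelian (idm P @* P) by rewrite morphim_idm.
pose V := transfer_morphism G abA.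
have trV g: g \in P -> V g = 0%R -> g = 1.
  move=> Pg; have Gg := subsetP sPG g Pg.
  have := rcosets_cycle_partition sPG Gg => partG.
  have trX := transversalP partG; set X := transversal _ _ in trX.
  rewrite /= (transfer_cycle_expansion sPG abA Gg trX).
  have sXG := transversal_sub trX.
  rewrite (eq_bigr (fun x => FiniteModule.fmod abA (g ^+ #|<[g]> : P :* x|))); last first.
    move=> x Xx /=; rewrite /restrm /= /idm; congr FiniteModule.fmod.
    apply: Burnside_fusion; rewrite ?groupV ?groupX ?(subsetP sXG) //.
    have := mulg_exp_card_rcosets P g x.
    by rewrite mem_rcoset /conjg invgK -mulgA.
  have PgP: g \in idm P @* P by rewrite morphim_idm.
  under eq_bigr => x _ do rewrite FiniteModule.fmodX //.
  rewrite ssralg.GRing.sumrMnr (sum_index_rcosets_cycle sPG Gg trX) => V0.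
  have gn1: g ^+ #|G : P| = 1.
    by rewrite -(FiniteModule.fmodK abA (groupX _ PgP)) FiniteModule.fmodX // V0.
  have coPn: coprime #|P| #|G : P| by have /and3P[_ pP] := sylP; apply: pnat_coprime.
  by rewrite -(expgK coPn Pg) gn1 expg1n.
exists ('ker V)%G; first exact: ker_normal.
split.
  by rewrite (isog_abelian (first_isog V)); apply: finalg.FinRing.zmod_abelian.
apply/trivgP/subsetP=> g /setIP[Vg Pg]; apply/set1gP/trV=> //.
exact: mker Vg.
Qed.
End BurnsideTransfer.

(** * Coprime conjugation, parity of involutions and faithful actions *)

(** For commuting [x] and [y] in the class, [x^-1 * y] lies in the r'-group [Q] and is also an
    r-element, hence trivial. So [u] is the only point of the class fixed by [<[u]>], which gives
    the congruence. *)
Lemma coprime_class_noncommuting (gT : finGroupType) (Q : {group gT}) r u :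
    prime r -> r^'.-group Q -> r.-elt u -> u \in 'N(Q) ->
  noncommuting (u ^: Q) /\ #|u ^: Q| = 1 %[mod r].
Proof.
move=> r_pr r'Q ru nQu.
have ncQ: {in u ^: Q &, forall x y, commute x y -> x = y}.
  move=> _ _ /imsetP[c Qc ->] /imsetP[d Qd ->] cxy.
  have memQ e: e \in Q -> u^-1 * u ^ e \in Q.
    by move=> Qe; rewrite -commgEl commgEr groupM // memJ_norm ?groupV.
  have Qxy: (u ^ c)^-1 * u ^ d \in Q.
    rewrite -[u ^ d](mulKVg u) mulgA groupM ?memQ //.
    by rewrite -[_ * u]invgK invMg invgK groupV memQ.
  apply/eqP; rewrite eq_mulVg1 -order_eq1; apply/eqP/(@pnat_1 r).
    apply: (@p_eltM _ r); rewrite ?p_eltV ?p_eltJ //.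
    exact/commute_sym/commuteV/commute_sym.
  exact: mem_p_elt r'Q Qxy.
split; first exact/noncommutingP.
have nuQ: [acts <[u]>, on u ^: Q | 'J].
  suffices: u \in 'N(u ^: Q | 'J) by rewrite -cycle_subG.
  rewrite astabsJ inE; apply/subsetP=> _ /imsetP[_ /imsetP[c Qc ->] ->].
  apply/imsetP; exists (c ^ u); rewrite ?memJ_norm //.
  by rewrite -conjgM conjgC conjgM {2}/conjg mulKg.
rewrite (pgroup_fix_mod ru nuQ).
suffices ->: 'Fix_(u ^: Q | 'J)(<[u]>) = [set u] by rewrite cards1.
apply/setP=> x; rewrite in_setI in_set1 afix_cycle; apply/andP/eqP=> [[Ux /afix1P fx]| ->].
  by apply: ncQ; rewrite ?class_refl //; apply/commgP/conjg_fixP.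
by rewrite class_refl; split=> //; apply/afix1P; rewrite /= /conjg mulKg.
Qed.

(** Some primary constituent of an element of ['N_G(P)] outside ['C(P)] is itself outside ['C(P)].
    It is not a p-element, since those of ['N_G(P)] lie in the abelian group [P]. *)
Lemma Sylow_norm_cent_elt (gT : finGroupType) (p : nat) (G P : {group gT}) :
    p.-Sylow(G) P -> abelian P -> ~~ ('N_G(P) \subset 'C(P)) ->
  exists r u, [/\ prime r, r != p, r.-elt u, u \in 'N_G(P) & u \notin 'C(P)].
Proof.
move=> sylP abelP /subsetPn[g Ng ncg].
have [/existsP[i nci] | ] := boolP [exists i : 'I_(#[g].+1), g.`_i \notin 'C(P)].
  pose r : nat := i; exists r, g.`_r.
  have rg: r.-elt g.`_r := p_elt_constt r g.
  have Nr: g.`_r \in 'N_G(P) by rewrite groupX.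
  have ntr: g.`_r != 1 by apply: contraNneq nci => ->; apply: group1.
  have r_pr: prime r.
    have: 1 < #[g.`_r] by rewrite order_gt1.
    move=> og; have: pdiv #[g.`_r] \in (r : nat_pred) by apply: pnatPpi rg _; rewrite pi_pdiv.
    by rewrite inE => /eqP <-; apply: pdiv_prime.
  split=> //; apply: contraNneq nci => /= def_r; rewrite -/r def_r in rg Nr *.
  have nsP: p.-Sylow('N_G(P)) P by rewrite Sylow_subnorm.
  apply: (subsetP abelP); have nP: P <| 'N_G(P) by rewrite normal_subnorm (pHall_sub sylP).
  by rewrite (mem_normal_Hall nsP nP Nr).
rewrite negb_exists => /forallP cg; case/negP: ncg.
rewrite -(prod_constt g) big_mkord group_prod // => i _; exact/negbNE/cg.
Qed.

(* Multiplying s by tperm x (s x) removes one 2-cycle of s. *)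
Lemma odd_perm_involution (T : finType) (s : {perm T}) :
  s * s = 1 -> exists2 m, #|[set x | s x != x]| = m.*2 & odd_perm s = odd m.
Proof.
have [n] := ubnP #|[set x | s x != x]|; elim: n s => // n IHn s ltn s2.
have sK x: s (s x) = x by rewrite -permM s2 perm1.
have [s0 | /set0Pn[x]] := eqVneq [set x | s x != x] set0.
  exists 0; first by rewrite s0 cards0.
  suffices ->: s = 1 by rewrite odd_perm1.
  apply/permP=> x; rewrite perm1; apply/eqP.
  by move/setP/(_ x): s0; rewrite !inE => /negbFE.
rewrite inE => nsx; pose t := tperm x (s x).
have st: t ^ s = t by rewrite tpermJ sK tpermC.
have cst: commute s t by apply/commute_sym/commgP/conjg_fixP.
have s't2: (s * t) * (s * t) = 1.
  by rewrite -mulgA (mulgA t) -cst -!mulgA tperm2 mulg1 s2.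
have supp: [set y | (s * t) y != y] = [set y | s y != y] :\: [set x; s x].
  apply/setP=> y; rewrite !inE permM negb_or /t.
  have [-> | nyx] := eqVneq y x; first by rewrite tpermR eqxx.
  have [-> | nysx] := eqVneq y (s x); first by rewrite sK tpermL eqxx.
  rewrite tpermD // ?(inj_eq perm_inj) 1?eq_sym //.
  by apply: contraNneq nysx => <-; rewrite sK.
have card_s: #|[set y | s y != y]| = #|[set y | (s * t) y != y]|.+2.
  rewrite supp (cardsD1 x) (cardsD1 (s x)) !inE nsx inj_eq ?nsx //=; last exact: perm_inj.
  by rewrite -setDDl.
have [|m om odd_m] := IHn (s * t) _ s't2; first by rewrite -ltnS (leq_trans _ ltn) // card_s.
exists m.+1; first by rewrite card_s om.
by move: odd_m; rewrite odd_permM odd_tperm eq_sym nsx addbT /= => <-; rewrite negbK.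
Qed.

Lemma derg_simple (gT : finGroupType) (G : {group gT}) :
  simple G -> ~~ abelian G -> G^`(1) = G.
Proof.
move=> /simpleP[_ simG] ncG; have [G1|//] := simG _ (der_normal 1 G).
by case/negP: ncG; rewrite /abelian; apply/commG1P.
Qed.

(** A nonabelian simple group is perfect, so it acts by even permutations, and [w] has an even
    number of 2-cycles. *)
Lemma simple_action_even (gT : finGroupType) (G : {group gT}) (sT : finType)
    (to : {action gT &-> sT}) (S : {set sT}) w :
    simple G -> ~~ abelian G -> [acts G, on S | to] -> w \in G -> w ^+ 2 = 1 ->
  4 %| #|S :\: 'Fix_to[w]|.
Proof.
move=> simG ncG actG Gw w2.
have nSG: actby_cond G S to by [].
pose f := actperm <[nSG]>.
have even_f: {in G, forall a, ~~ odd_perm (f a)}.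
  move=> a; rewrite -{1}(derg_simple simG ncG) => G'a; rewrite -Alt_even.
  have sGd: G \subset 'dom f by [].
  suffices: f @* G^`(1) \subset 'Alt_sT.
    by move/subsetP; apply; apply: mem_morphim => //; apply: subsetP G'a; apply: der_sub.
  rewrite morphim_der // gen_subG; apply/subsetP=> _ /imset2P[c d _ _ ->].
  by rewrite Alt_even !odd_permM !odd_permV; do 2!case: odd_perm.
have [|m om odd_m] := @odd_perm_involution _ (f w).
  by rewrite -morphM // (_ : w * w = 1) ?morph1 // -w2 expgS expg1.
suffices <-: [set x | f w x != x] = S :\: 'Fix_to[w].
  by rewrite om -muln2 (@dvdn_pmul2r 2 2) // dvdn2 -odd_m even_f.
apply/setP=> x; rewrite in_set in_setD /f actpermE /= /actby.
case Sx: (x \in S) => /=; last by rewrite eqxx andbF.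
by rewrite Gw andbT; congr (~~ _); apply/eqP/afix1P.
Qed.

Lemma prime_group_cycle (gT : finGroupType) (P : {group gT}) z :
  prime #|P| -> z \in P -> z != 1 -> P :=: <[z]>.
Proof.
move=> /primeP[_ /(_ #[z])] p_pr Pz ntz.
apply/eqP; rewrite eq_sym eqEcard cycle_subG Pz /=.
by move: p_pr; rewrite order_dvdG // order_eq1 (negPf ntz) => /(_ isT)/eqP <-.
Qed.

Lemma card_faithful_action (aT : finGroupType) (sT : finType)
    (to : {action aT &-> sT}) (G : {group aT}) (S : {set sT}) :
  [acts G, on S | to] -> 'C_G(S | to) = 1 -> #|G| <= #|S|`!.
Proof.
move=> actG faith; have nSG: actby_cond G S to by [].
rewrite -card_perm -(cardsE (perm_on S)).
have injf: {in G &, injective (actperm <[nSG]>)}.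
  move=> a b Ga Gb eqab; apply/eqP; rewrite eq_mulgV1; apply/eqP/set1gP.
  rewrite -faith in_setI groupM ?groupV //=; apply/astabP=> x Sx.
  move/permP/(_ x): eqab; rewrite !actpermE /= /actby Sx Ga Gb /= actM => ->.
  by rewrite actK.
rewrite -(card_in_imset injf); apply/subset_leq_card/subsetP=> _ /imsetP[a Ga ->].
rewrite inE; apply/subsetP=> x; rewrite inE actpermE /= /actby.
by case: (x \in S) => //=; rewrite eqxx.
Qed.

(** * Noncommuting sets with one element from each Sylow subgroup *)

Section Sylow.

Variables (gT : finGroupType) (p : nat) (G : {group gT}).
Implicit Types P R : {group gT}.

(** Two commuting p-elements generate a p-group, contained in one Sylow subgroup, which must be the
    one that either element determines. The parameter [prop] carries along further properties of the
    chosen elements. *)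
Lemma Sylow_regular_noncommuting (prop : {group gT} -> gT -> Prop) :
    (forall P, p.-Sylow(G) P -> exists z, [/\ z \in P,
       forall R, p.-Sylow(G) R -> z \in R -> R :=: P & prop P z]) ->
  exists A : {set gT}, [/\ A \subset G, noncommuting A, #|A| = #|'Syl_p(G)|
    & {in A, forall a, exists P, [/\ p.-Sylow(G) P, a \in P & prop P a]}].
Proof.
move=> reg; pose ok P z := p.-Sylow(G) P -> [/\ z \in P,
       forall R, p.-Sylow(G) R -> z \in R -> R :=: P & prop P z].
have [f okf]: exists f, forall P, ok P (f P).
  apply: fin_all_exists => P; have [/reg[z okz] | nsylP] := boolP (p.-Sylow(G) P).
    by exists z.
  by exists 1 => sylP; rewrite sylP in nsylP.
have [|ncA oA] := @noncommuting_imset _ _ 'Syl_p(G) f.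
  move=> P R; rewrite !inE => sylP sylR cPR; apply: val_inj => /=.
  have [Pz uP _] := okf P sylP; have [Rz uR _] := okf R sylR.
  have sG: <<[set f P; f R]>> \subset G.
    rewrite gen_subG subUset !sub1set (subsetP (pHall_sub sylP)) //.
    by rewrite (subsetP (pHall_sub sylR)).
  have pA: p.-group <<[set f P; f R]>>.
    have ->: <<[set f P; f R]>> = <[f P]> * <[f R]>.
      by rewrite -cent_joinEl ?cents_cycle //= joing_idl joing_idr.
    rewrite pgroupM; have pf (Q : {group gT}): p.-Sylow(G) Q -> f Q \in Q -> p.-group <[f Q]>.
      by move=> sylQ Qf; apply: mem_p_elt (pHall_pgroup sylQ) Qf.
    by rewrite !pf.
  case: (Sylow_superset sG pA) => Q sylQ sQ.
  have [Qf QR]: f P \in Q /\ f R \in Q.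
    by split; apply: (subsetP sQ); rewrite mem_gen // !inE eqxx ?orbT.
  exact: etrans (esym (uP Q sylQ Qf)) (uR Q sylQ QR).
exists (f @: 'Syl_p(G)); split=> //.
  apply/subsetP=> _ /imsetP[P SylP ->]; have sylP: p.-Sylow(G) P by rewrite inE in SylP.
  by have [Pf _ _] := okf P sylP; apply: subsetP (pHall_sub sylP) _ Pf.
move=> _ /imsetP[P SylP ->]; have sylP: p.-Sylow(G) P by rewrite inE in SylP.
exists P.
by have [Pf _ propP] := okf P sylP.
Qed.

Lemma Sylow_prime_noncommuting P0 : prime p -> p.-Sylow(G) P0 -> #|P0| = p ->
  exists A : {set gT}, [/\ A \subset G, noncommuting A, #|A| = #|'Syl_p(G)|
    & {in A, forall a, exists2 P : {group gT}, p.-Sylow(G) P & P :=: <[a]> /\ a != 1}].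
Proof.
move=> p_pr sylP0 oP0.
have oP P: p.-Sylow(G) P -> #|P| = p.
  by move=> sylP; rewrite (card_Hall sylP) -(card_Hall sylP0).
have defP P z: p.-Sylow(G) P -> z \in P -> z != 1 -> P :=: <[z]>.
  by move=> sylP; apply: prime_group_cycle; rewrite oP.
have [P sylP|A [sAG ncA oA memA]] := @Sylow_regular_noncommuting (fun _ z => z != 1).
  have ntP: P :!=: 1 by rewrite -cardG_gt1 oP ?prime_gt1.
  have [z Pz ntz] := trivgPn _ ntP; exists z; split=> // R sylR Rz.
  by rewrite (defP R z) // (defP P z).
exists A; split=> // a /memA[P [sylP Pa nta]]; exists P => //.
by rewrite -(defP P a).
Qed.

End Sylow.

(** * Sylow subgroups of a nonabelian simple group *)

Section SimpleGroup.

Variables (gT : finGroupType) (G : {group gT}).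
Hypotheses (simG : simple G) (ncG : ~~ abelian G).
Implicit Types P R : {group gT}.

Lemma simple_nonabelian_nonsolvable : ~~ solvable G.
Proof.
have ntG: G :!=: 1 by case: eqP ncG => // ->; rewrite abelian1.
apply/negP=> solG; have := sol_der1_proper solG (subxx G) ntG.
by rewrite (derg_simple simG ncG) properxx.
Qed.

Lemma simple_action_faithful (sT : finType) (to : {action gT &-> sT}) (S : {set sT}) :
  [acts G, on S | to] -> ~~ (S \subset 'Fix_to(G)) -> 'C_G(S | to) = 1.
Proof.
move=> actG nfS; have /simpleP[_ sim] := simG.
have nsC: 'C_G(S | to) <| G.
  rewrite /normal subsetIl normsI ?normG //.
  exact: subset_trans actG (astab_norm _ _).
have [//|eqG] := sim _ nsC; case/negP: nfS.
by rewrite -astabC -eqG subsetIr.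
Qed.

Lemma acts_Syl p : [acts G, on 'Syl_p(G) | 'JG].
Proof. exact/atrans_acts/Syl_trans. Qed.

Lemma simple_Sylow_not_normal p P :
  prime p -> p %| #|G| -> p.-Sylow(G) P -> ~~ (G \subset 'N(P)).
Proof.
move=> p_pr p_dv sylP; apply/negP=> nPG; have /simpleP[_ sim] := simG.
have [|P1|eqP] := sim P; first by rewrite /normal (pHall_sub sylP).
  have := card_Hall sylP; rewrite P1 cards1 => /esym/eqP.
  by rewrite p_part_eq1 mem_primes p_pr p_dv cardG_gt0.
have := simple_nonabelian_nonsolvable.
by rewrite -eqP (pgroup_sol (pHall_pgroup sylP)).
Qed.

Lemma simple_Syl_faithful p :
  prime p -> p %| #|G| -> 'C_G('Syl_p(G) | 'JG) = 1.
Proof.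
move=> p_pr p_dv; apply: simple_action_faithful (acts_Syl p) _.
have [P sylP] := Sylow_exists p G; apply/subsetPn; exists P; first by rewrite inE.
by rewrite afixJG (simple_Sylow_not_normal p_pr p_dv sylP).
Qed.

Lemma simple_card_Syl_gt1 p : prime p -> p %| #|G| -> 1 < #|'Syl_p(G)|.
Proof.
move=> p_pr p_dv; have [P sylP] := Sylow_exists p G.
rewrite (card_Syl sylP) indexg_gt1 subsetI subxx.
exact: simple_Sylow_not_normal sylP.
Qed.

Lemma simple_leq_card_Syl_fact p :
  prime p -> p %| #|G| -> #|G| <= #|'Syl_p(G)|`!.
Proof.
move=> p_pr p_dv; apply: card_faithful_action (acts_Syl p) _.
exact: simple_Syl_faithful.
Qed.

(** The number is 1 modulo 3 and greater than 1; the value 4 would embed [G] in a symmetric group of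
    order 24. *)
Lemma simple_card_Syl3 : 3 %| #|G| -> 24 < #|G| ->
  #|'Syl_3(G)| = 7 \/ 9 < #|'Syl_3(G)|.
Proof.
move=> dv3 gt24; have := simple_card_Syl_gt1 (isT : prime 3) dv3.
have := card_Syl_mod G (isT : prime 3).
have := simple_leq_card_Syl_fact (isT : prime 3) dv3.
case: #|'Syl_3(G)| => [|[|[|[|[|[|[|[|[|[|n]]]]]]]]]] // leG _ _; auto.
by rewrite leqNgt gt24 in leG.
Qed.

Lemma Sylow_norm_eq p P R : p.-Sylow(G) P -> p.-Sylow(G) R -> R \subset 'N(P) -> R :=: P.
Proof.
move=> sylP sylR nPR; apply/eqP; rewrite eqEcard (card_Hall sylP) (card_Hall sylR) leqnn andbT.
have sylN: p.-Sylow('N_G(P)) P by rewrite Sylow_subnorm.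
rewrite (sub_normal_Hall sylN) ?(pHall_pgroup sylR) ?normal_subnorm ?(pHall_sub sylP) //.
by rewrite subsetI (pHall_sub sylR).
Qed.

Lemma afix_Syl p P : p.-Sylow(G) P -> 'Fix_('Syl_p(G) | 'JG)(P) = [set P].
Proof.
move=> sylP; apply/setP=> R; rewrite in_setI in_set1 inE afixJG.
apply/andP/eqP=> [[sylR nRP] | ->]; last by rewrite normG.
by apply/val_inj/esym; apply: Sylow_norm_eq sylR sylP nRP.
Qed.

(** With [z] from [small_action_regular], any Sylow subgroup containing [z] centralizes [P] by
    [small_action_cent]. For [P] itself this is commutativity; any other would normalize [P], hence
    equal it. *)
Lemma Sylow_small_action_regular p (sT : finType) (to : {action gT &-> sT}) (S : {set sT}) P :
    #|S| < p ^ 2 -> [acts G, on S | to] -> 'C_G(S | to) = 1 -> p.-Sylow(G) P ->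
  abelian P /\ exists z, [/\ z \in P, forall R, p.-Sylow(G) R -> z \in R -> R :=: P
     & 'Fix_(S | to)[z] = 'Fix_(S | to)(P)].
Proof.
move=> ltS actG faith sylP.
have actR R: p.-Sylow(G) R -> [acts R, on S | to].
  by move=> sylR; apply: subset_trans (pHall_sub sylR) actG.
have [z Pz fixz] := small_action_regular ltS (pHall_pgroup sylP) (actR P sylP).
have cent R: p.-Sylow(G) R -> z \in R -> R \subset 'C(P).
  move=> sylR Rz; have pP := pHall_pgroup sylP; have pR := pHall_pgroup sylR.
  apply: (small_action_cent ltS pP (actR P sylP) pR (actR R sylR) Pz Rz fixz).
  by apply/trivgP; rewrite -faith setSI // join_subG (pHall_sub sylP) (pHall_sub sylR).
split; first exact: cent.
exists z; split=> // [R sylR Rz].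
apply: (Sylow_norm_eq sylP sylR).
exact: subset_trans (cent R sylR Rz) (cent_sub _).
Qed.

Lemma simple_Burnside_transfer p P :
    prime p -> p %| #|G| -> p.-Sylow(G) P -> abelian P ->
  ~~ ('N_G(P) \subset 'C(P)).
Proof.
move=> p_pr p_dv sylP abelP; apply/negP=> cNP.
have [N nsNG [abN tiN]] := Burnside_transfer_ker sylP abelP cNP.
have /simpleP[_ sim] := simG; have [N1|NG] := sim N nsNG.
  case/negP: ncG; rewrite (isog_abelian (quotient1_isog G)).
  by rewrite -N1.
have P1: P :=: 1 by rewrite -tiN NG; apply/esym/setIidPr/(pHall_sub sylP).
have := simple_Sylow_not_normal p_pr p_dv sylP.
by rewrite P1 norm1 subsetT.
Qed.

End SimpleGroup.

(** * Simple groups with exactly p + 1 Sylow p-subgroups *)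

Section SylowSuccPrime.

Variables (gT : finGroupType) (G : {group gT}) (p : nat) (P : {group gT}).
Hypotheses (simG : simple G) (ncG : ~~ abelian G).
Hypotheses (p_pr : prime p) (p_dv : p %| #|G|) (card_Syl_p : #|'Syl_p(G)| = p.+1).
Hypothesis (sylP : p.-Sylow(G) P).
Implicit Types R : {group gT}.

Let p_gt1 := prime_gt1 p_pr.
Let small_Syl : #|'Syl_p(G)| < p ^ 2.
Proof. by rewrite card_Syl_p; nia. Qed.
Let sPG := pHall_sub sylP.
Let pP := pHall_pgroup sylP.
Let actP : [acts P, on 'Syl_p(G) | 'JG] := subset_trans sPG (acts_Syl G p).
Let faith := simple_Syl_faithful simG ncG p_pr p_dv.

Let nfix R : p.-Sylow(G) R -> R :!=: P -> R \notin 'Fix_('JG)(P).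
Proof.
move=> sylR; apply: contra => fR; have: R \in 'Fix_('Syl_p(G) | 'JG)(P).
  by rewrite in_setI inE sylR.
by rewrite (afix_Syl sylP) => /set1P->.
Qed.

Let orbitR R : p.-Sylow(G) R -> R :!=: P -> orbit 'JG P R = 'Syl_p(G) :\ P.
Proof.
move=> sylR neR; have SR: R \in 'Syl_p(G) by rewrite inE.
apply/eqP; rewrite eqEcard (small_action_orbit small_Syl pP actP SR (nfix sylR neR)).
have := cardsD1 P 'Syl_p(G); rewrite card_Syl_p [P \in _]inE sylP add1n => -[<-].
rewrite leqnn andbT subsetD1 acts_sub_orbit ?SR //=.
have orbP: orbit 'JG P P = [set P] by apply/orbit1P; rewrite afixJG normG.
by rewrite orbit_sym orbP in_set1; apply: contra neR => /eqP->.
Qed.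

Lemma SylS_conj R R' :
    p.-Sylow(G) R -> p.-Sylow(G) R' -> R :!=: P -> R' :!=: P ->
  exists2 z, z \in P & R' :=: R :^ z.
Proof.
move=> sylR sylR' neR neR'; have: R' \in orbit 'JG P R.
  by rewrite orbitR // in_setD1 inE sylR' andbT; apply: contra neR' => /eqP->.
by case/orbitP=> z Pz <-; exists z.
Qed.

Lemma SylS_other : exists2 R : {group gT}, p.-Sylow(G) R & R :!=: P.
Proof.
have: 0 < #|'Syl_p(G) :\ P|.
  have := cardsD1 P 'Syl_p(G); rewrite card_Syl_p [P \in _]inE sylP add1n => -[<-].
  exact: prime_gt0.
case/card_gt0P=> R; rewrite in_setD1 inE => /andP[neR sylR]; by exists R.
Qed.

(** The Sylow subgroups other than [P] form a single [P]-orbit, so an element of [P] normalizing one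
    of them normalizes all, and the action is faithful. *)
Lemma SylS_regular R : p.-Sylow(G) R -> R :!=: P -> 'N_P(R) = 1.
Proof.
move=> sylR neR; have SR: R \in 'Syl_p(G) by rewrite inE.
apply/trivgP; rewrite -faith; apply/subsetP=> c /setIP[Pc nRc].
rewrite in_setI (subsetP sPG) //=; apply/astabP=> R'; rewrite inE => sylR'.
have [eqR | neR'] := eqVneq R' P.
  by apply: val_inj; rewrite /= eqR conjGid.
have OR': R' \in orbit 'JG P R by rewrite orbitR // in_setD1 inE neR'.
apply/astab1P/(subsetP (small_action_stab small_Syl pP actP SR OR')).
by rewrite in_setI Pc astab1JG.
Qed.

Lemma SylS_card : #|P| = p.
Proof.
have [R sylR neR] := SylS_other; have SR: R \in 'Syl_p(G) by rewrite inE.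
rewrite -(small_action_orbit small_Syl pP actP SR (nfix sylR neR)).
by rewrite card_orbit astab1JG SylS_regular // indexg1.
Qed.

(** For [c] centralizing [P] there is [z] in [P] with [R :^ c = R :^ z]. Then [c * z^-1] normalizes
    [R] and commutes with [P], so it normalizes every conjugate of [R] under [P], and is trivial by
    faithfulness. *)
Lemma SylS_cent : 'C_G(P) = P.
Proof.
have abelP: abelian P by rewrite cyclic_abelian // prime_cyclic // SylS_card.
apply/eqP; rewrite eqEsubset subsetI sPG [P \subset 'C(P)]abelP !andbT.
have [R sylR neR] := SylS_other; have SR: R \in 'Syl_p(G) by rewrite inE.
have regC c: c \in 'C_G(P) -> c \in 'N(R) -> c = 1.
  case/setIP=> Gc cPc nRc; apply/set1gP; rewrite -faith in_setI Gc /=.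
  apply/astabP=> R'; rewrite inE => sylR'; apply: val_inj => /=.
  have [-> | neR'] := eqVneq (R' : {set gT}) P.
    by rewrite (normP (subsetP (cent_sub _) c cPc)).
  have [z Pz ->] := SylS_conj sylR sylR' neR neR'.
  by rewrite -conjsgM -(centP cPc) // conjsgM (normP nRc).
apply/subsetP=> c Cc; have /setIP[Gc cPc] := Cc.
have neRc: R :^ c != P.
  apply: contra neR => /eqP eqRc; rewrite -(inj_eq (@conjsg_inj _ c)) eqRc.
  by rewrite (normP (subsetP (cent_sub _) c cPc)).
have sylRc: p.-Sylow(G) (R :^ c)%G by rewrite pHallJ.
have [z Pz /= defRc] := SylS_conj sylR sylRc neR neRc.
suffices: c * z^-1 = 1 by move/(canRL (mulgKV z)); rewrite mul1g => ->.
apply: regC; last by rewrite inE conjsgM defRc -conjsgM mulgV conjsg1.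
by rewrite groupM // groupV in_setI (subsetP sPG) //= (subsetP abelP).
Qed.

(* If R' = R :^ z then [~ u, z^-1] lies in 'N_P(R) = 1. *)
Lemma SylS_fix3 u R R' :
    u \in 'N(P) -> p.-Sylow(G) R -> p.-Sylow(G) R' ->
    R :!=: P -> R' :!=: P -> R :!=: R' ->
  u \in 'N(R) -> u \in 'N(R') -> u \in 'C(P).
Proof.
move=> nPu sylR sylR' neR neR' neRR' nRu nR'u.
have [z Pz defR'] := SylS_conj sylR sylR' neR neR'.
have ntz: z != 1 by apply: contraNneq neRR' => z1; rewrite defR' z1 conjsg1.
have defP: P :=: <[z]> by apply: prime_group_cycle; rewrite ?SylS_card.
have: [~ u, z^-1] \in 'N_P(R).
  rewrite in_setI; apply/andP; split.
    by rewrite commgEr invgK groupM ?groupV // memJ_norm.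
  by rewrite commgEl groupM ?groupV // -mem_conjg -normJ -defR'.
rewrite SylS_regular // => /set1gP/eqP/commgP/commuteV; rewrite invgK => cuz.
by rewrite defP cent_cycle; apply/cent1P.
Qed.

(** Here [t] is the index of [P] in its normalizer. The quotient embeds in the automorphism group of
    [P], of order [p.-1], and is nontrivial by Burnside transfer. *)
Lemma SylS_norm_card :
  exists t, [/\ #|'N_G(P)| = (p * t)%N, #|G| = (p.+1 * (p * t))%N, t %| p.-1 & 1 < t].
Proof.
have sPN: P \subset 'N_G(P) by rewrite subsetI sPG normG.
have oN: #|'N_G(P)| = (p * #|'N_G(P) : P|)%N by rewrite -SylS_card Lagrange.
exists #|'N_G(P) : P|; split=> //.
- by rewrite -oN -card_Syl_p (card_Syl sylP) mulnC Lagrange // subsetIl.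
- have ->: #|'N_G(P) : P| = #|conj_aut P @* 'N_G(P)|.
    have NC: 'N_G(P) :&: 'C(P) = P.
      by rewrite -setIA (setIidPr (cent_sub _)) SylS_cent.
    rewrite card_morphim ker_conj_aut (setIidPr (subsetIr _ _)) /=.
    by rewrite -[RHS]indexgI NC.
  have cycP: cyclic P by rewrite prime_cyclic ?SylS_card.
  by rewrite -(totient_prime p_pr) -SylS_card -card_Aut_cyclic // cardSg ?Aut_conj_aut.
have abelP: abelian P by rewrite cyclic_abelian // prime_cyclic // SylS_card.
rewrite indexg_gt1; apply: contra (simple_Burnside_transfer simG ncG p_pr p_dv sylP abelP).
by move=> sNP; apply: subset_trans sNP abelP.
Qed.

End SylowSuccPrime.

(** * Excluding the primes above 3 when noncommuting sets have at most 20 elements *)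

Section FewNoncommuting.

Variables (gT : finGroupType) (G : {group gT}).
Hypotheses (simG : simple G) (ncG : ~~ abelian G).
Hypothesis leG : noncommuting_le 20 G.
Implicit Types P R : {group gT}.

Lemma few_card_Syl p : prime p -> 4 < p -> p %| #|G| ->
  #|'Syl_p(G)| <= 20 /\ forall P, p.-Sylow(G) P -> abelian P.
Proof.
move=> p_pr p_gt4 p_dv; have [//|x G1x ltx] := noncommuting_le_small_class _ ncG leG.
have /setD1P[ntx Gx] := G1x.
have actx: [acts G, on x ^: G | 'J] by rewrite -orbitJ acts_orbit ?subsetT.
have faith: 'C_G(x ^: G | 'J) = 1.
  apply: simple_action_faithful => //; apply/subsetPn; exists x; first exact: class_refl.
  rewrite afixJ; apply/negP=> cGx; have /simpleP[_ sim] := simG.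
  have [Z1 | /center_idP abG] := sim _ (center_normal G); last by case/negP: ncG.
  have: x \in 'Z(G) by rewrite in_setI Gx.
  by rewrite Z1 => /set1gP x1; rewrite x1 eqxx in ntx.
have small: #|x ^: G| < p ^ 2 by nia.
have reg P (sylP : p.-Sylow(G) P) := Sylow_small_action_regular small actx faith sylP.
split=> [|P /reg[]//].
have [P sylP|A [sAG ncA <- _]] := @Sylow_regular_noncommuting _ p G (fun _ _ => True).
  by have [_ [z [Pz uz _]]] := reg P sylP; exists z.
exact: leG.
Qed.

(** As [2 * p + 1 > 20], there are [p.+1] Sylow subgroups. Take a nontrivial class of size below 20.
    If [p] divided its size, the size would be [p], impossible for a simple group by Burnside. So
    some Sylow subgroup [P] centralizes [x]; then [x] generates [P], and the class has [p.+1 * t]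
    elements, at least 20. *)
Lemma few_no_large_prime p : prime p -> 10 < p -> ~~ (p %| #|G|).
Proof.
move=> p_pr p_gt10; apply/negP=> p_dv.
have [|leS _] := few_card_Syl p_pr _ p_dv; first by lia.
have card_S: #|'Syl_p(G)| = p.+1.
  have := simple_card_Syl_gt1 simG ncG p_pr p_dv.
  have := divn_eq #|'Syl_p(G)| p; rewrite card_Syl_mod //.
  by case: (_ %/ p) leS => [|[|k]]; nia.
have [//|x G1x ltx] := noncommuting_le_small_class _ ncG leG.
have /setD1P[ntx Gx] := G1x.
have p'x: ~~ (p %| #|x ^: G|).
  apply/negP=> /dvdnP[k def_k].
  have k1: k = 1%N by have := indexg_gt0 G 'C_G[x]; rewrite index_cent1; nia.
  have: x ^: G \in (classes G)^#.
    by rewrite in_setD1 mem_classes // classG_eq1 ntx.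
  move/(primes_class_simple_gt1 simG ncG).
  by rewrite def_k k1 mul1n primes_prime.
have [P sylC] := Sylow_exists p 'C_G[x].
have sPG: P \subset G := subset_trans (pHall_sub sylC) (subsetIl _ _).
have sylP: p.-Sylow(G) P.
  rewrite pHallE sPG (card_Hall sylC) -(Lagrange (subsetIl G 'C[x])) partnM //.
  suffices ->: partn #|G : 'C_G[x]| p = 1%N by rewrite muln1 eqxx.
  by apply/eqP; rewrite index_cent1 p_part_eq1 mem_primes (negPf p'x) !andbF.
have defC := SylS_cent simG ncG p_pr p_dv card_S sylP.
have oP := SylS_card simG ncG p_pr p_dv card_S sylP.
have [t [oN oG _ t_gt1]] := SylS_norm_card simG ncG p_pr p_dv card_S sylP.
have Px: x \in P.
  rewrite -defC in_setI Gx -sub_cent1.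
  exact: subset_trans (pHall_sub sylC) (subsetIr _ _).
have defP: P :=: <[x]> by apply: prime_group_cycle; rewrite ?oP.
move: ltx; rewrite -index_cent1 -cent_cycle -defP defC.
have /eqP := Lagrange sPG; rewrite oP oG mulnCA eqn_pmul2l ?prime_gt0 // => /eqP->.
rewrite ltnNge; case/negP; apply: (leq_trans _ (leq_mul (_ : 10 <= p.+1) t_gt1)) => //.
exact: leqW (ltnW p_gt10).
Qed.

(** Burnside transfer gives an r-element [u] that normalizes but does not centralize [P]. Its class
    under [P] is noncommuting, of size a power of 5 other than 1 and at most 20, hence 5. Then [5 =
    1 %[mod r]] forces [r = 2]. *)
Lemma few_class_five P : 5 %| #|G| -> 5.-Sylow(G) P ->
  exists u, [/\ 2.-elt u, u \in 'N_G(P), u \notin 'C(P), noncommuting (u ^: P)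
              & #|u ^: P| = 5].
Proof.
move=> dv5 sylP; have [//|//|_ /(_ P sylP) abelP] := @few_card_Syl 5 _ _ dv5.
have ncN := simple_Burnside_transfer simG ncG (isT : prime 5) dv5 sylP abelP.
have [r [u [r_pr r5 ru Nu ncu]]] := Sylow_norm_cent_elt sylP abelP ncN.
have /setIP[Gu nPu] := Nu.
have r'P: r^'.-group P.
  apply: sub_in_pnat (pHall_pgroup sylP) => q _.
  by rewrite !inE => /eqP->; rewrite eq_sym.
have [ncuP modr] := coprime_class_noncommuting r_pr r'P ru nPu.
have o5: #|u ^: P| = 5.
  have le20: #|u ^: P| <= 20.
    apply: leG => //; apply/subsetP=> _ /imsetP[c Pc ->].
    by rewrite groupJ // (subsetP (pHall_sub sylP)).
  have [k ok]: {k | #|u ^: P| = (5 ^ k)%N}.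
    apply: p_natP; apply: pnat_dvd (pHall_pgroup sylP).
    by rewrite -index_cent1 dvdn_indexg.
  case: k ok le20 => [|[|k]] ok; rewrite ok //; last first.
    by rewrite !expnS; have := expn_gt0 5 k; move: (5 ^ k)%N => m {ok}; clear; lia.
  move=> _; case/negP: ncu; rewrite -sub_cent1; apply/setIidPl/eqP.
  by rewrite eqEcard subsetIl -(Lagrange (subsetIl P 'C[u])) index_cent1 ok muln1 leqnn.
have r2: r = 2.
  move/eqP: modr; rewrite o5 eqn_mod_dvd // -[(5 - 1)%N]/4 => r4.
  have r_le4 := @dvdn_leq r 4 isT r4.
  by case: r {r5 ru r'P} r_le4 r4 r_pr => [|[|[|[|[|]]]]].
by exists u; rewrite r2 in ru.
Qed.

(* An involution commuting with a 5-element that normalizes only one of 16 Sylow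
   5-subgroups would fix 6 of them, hence act as an odd permutation. *)
Lemma few_card_Syl5_neq16 : 5 %| #|G| -> #|'Syl_5(G)| != 16.
Proof.
move=> dv5; apply/eqP=> card_S.
have faith := simple_Syl_faithful simG ncG (isT : prime 5) dv5.
have small: #|'Syl_5(G)| < 5 ^ 2 by rewrite card_S.
have [|A [sAG ncA oA memA]] := @Sylow_regular_noncommuting _ 5 G
    (fun P z => 'Fix_('Syl_5(G) | 'JG)[z] = [set P]).
  move=> P sylP; rewrite -(afix_Syl sylP).
  by have [] := Sylow_small_action_regular small (acts_Syl G 5) faith sylP.
have [P sylP] := Sylow_exists 5 G; have [u [u2 Nu ncu ncB oB]] := few_class_five dv5 sylP.
have [|ncAB oAB] := noncommutingU ncA ncB; last first.
  have: #|A :|: u ^: P| <= 20.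
    apply: leG ncAB; rewrite subUset sAG; apply/subsetP=> _ /imsetP[c Pc ->].
    by have [[Gu _] Gc] := (setIP Nu, subsetP (pHall_sub sylP) c Pc); apply: groupJ.
  by rewrite oAB oA oB card_S.
move=> a c /memA[R [sylR Ra fixa]] /imsetP[d Pd def_c] cac.
have Gd := subsetP (pHall_sub sylP) d Pd.
have Gc: c \in G by rewrite def_c groupJ //; case/setIP: Nu.
have ntc: c != 1 by rewrite def_c conjg_eq1; apply: contraNneq ncu => ->; apply: group1.
have c2: 2.-elt c by rewrite def_c p_eltJ.
have ntC: <[c]> != 1 by rewrite cycle_eq1.
have [_ dv2 _] := pgroup_pdiv c2 ntC; have [w cw ow] := Cauchy (isT : prime 2) dv2.
have Gw: w \in G by apply: subsetP cw; rewrite cycle_subG.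
have caw: commute a w by have /cycleP[i ->] := cw; apply: commuteX.
have w2: w ^+ 2 = 1 by rewrite -ow expg_order.
have := simple_action_even simG ncG (acts_Syl G 5) Gw w2.
rewrite -(cardsID 'Fix_'JG[w]) in card_S; set F := 'Syl_5(G) :&: _ in card_S.
have actF: [acts <[a]>, on F | 'JG].
  apply: actsI; first apply: subset_trans _ (acts_Syl G 5).
    by rewrite cycle_subG (subsetP (pHall_sub sylR)).
  by apply: acts_fix_norm; rewrite cycle_subG; apply/cent1P.
have a5: 5.-group <[a]> by apply: mem_p_elt (pHall_pgroup sylR) Ra.
have := pgroup_fix_mod a5 actF.
have ->: 'Fix_(F | 'JG)(<[a]>) = [set R].
  rewrite afix_cycle setIAC fixa; apply/setIidPl; rewrite sub1set.
  apply/afix1P/set1P; rewrite -fixa in_setI inE /= pHallJ // sylR.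
  apply/afix1P/val_inj; rewrite /= -conjsgM -caw conjsgM conjGid //.
rewrite cards1.
move: card_S; set D := _ :\: _; have: D != set0.
  apply/eqP=> /eqP; rewrite setD_eq0 => sSw.
  have: w \in 'C_G('Syl_5(G) | 'JG) by rewrite in_setI Gw /= -sub1set astabC.
  by rewrite faith => /set1gP w1; rewrite w1 order1 in ow.
(* Now [m + n = 16] with [m] equal to 1 modulo 5 and [n] positive: [n] is 15, 10 or 5, never a
   multiple of 4. *)
rewrite -card_gt0. move: #|F| #|D| => m n; clear; lia.
Qed.

Lemma few_not_dvd5 : ~~ (5 %| #|G|).
Proof.
apply/negP=> dv5; have [//|//|le20 abS] := @few_card_Syl 5 _ _ dv5.
have card_S: #|'Syl_5(G)| = 6.
  have := simple_card_Syl_gt1 simG ncG (isT : prime 5) dv5.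
  have := card_Syl_mod G (isT : prime 5).
  have: #|'Syl_5(G)| != 11.
    apply: contraNneq (few_no_large_prime (isT : prime 11) isT) => <-.
    exact: card_Syl_dvd.
  have := few_card_Syl5_neq16 dv5.
  by move: #|'Syl_5(G)| le20 => n; do 21?[case: n => [|n] //].
have [P sylP] := Sylow_exists 5 G.
have sPG := pHall_sub sylP.
have [t [oN oG dvt t_gt1]] := SylS_norm_card simG ncG (isT : prime 5) dv5 card_S sylP.
have cP R sylR := @SylS_cent _ G 5 R simG ncG isT dv5 card_S sylR.
have oP := @SylS_card _ G 5 P simG ncG isT dv5 card_S sylP.
have [u [u2 Nu ncu ncC oC]] := few_class_five dv5 sylP.
have sCG: u ^: P \subset G.
  apply/subsetP=> _ /imsetP[c Pc ->].
  by have [[Gu _] Gc] := (setIP Nu, subsetP sPG c Pc); apply: groupJ.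
have [A [sAG ncA oA memA]] := Sylow_prime_noncommuting (isT : prime 5) sylP oP.
have{dvt t_gt1} t24 : (t == 2) || (t == 4).
  have t_le4 : t <= 4 by apply: dvdn_leq _ dvt.
  by case: t {oN oG} t_le4 t_gt1 dvt => [|[|[|[|[|t]]]]].
have [P3 sylP3] := Sylow_exists 3 G.
(* Since [#|G| = 6 * 5 * t], the order is 60 or 120. *)
have [dv3 gt24 p3 nd7]:
    [/\ 3 %| #|G|, 24 < #|G|, partn #|G| 3 = 3 & ~~ (7 %| #|G|)].
  by rewrite p_part oG; case/orP: t24 => /eqP->; split; vm_compute.
have oP3: #|P3| = 3 by rewrite (card_Hall sylP3).
have [B [sBG ncB oB memB]] := Sylow_prime_noncommuting (isT : prime 3) sylP3 oP3.
have gt9: 9 < #|'Syl_3(G)|.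
  have [o7|//] := simple_card_Syl3 simG ncG dv3 gt24.
  by have := card_Syl_dvd 3 G; rewrite o7 (negPf nd7).
have centA a b: a \in A -> b \in G -> commute a b -> 5.-elt b.
  case/memA=> R sylR [defR nta] Gb cab.
  have: b \in 'C_G(R) by rewrite in_setI Gb defR cent_cycle; apply/cent1P.
  by rewrite cP //; apply: mem_p_elt (pHall_pgroup sylR).
have p'elt q (x : gT) : prime q -> q != 5 -> q.-elt x -> 5.-elt x -> x = 1.
  move=> q_pr q5 qx x5; apply/eqP; rewrite -order_eq1; apply/eqP/(@pnat_1 5) => //.
  by apply: sub_in_pnat qx => r _; rewrite !inE => /eqP->.
have memB3 b: b \in B -> #[b] = 3.
  case/memB=> R sylR [defR ntb]; rewrite orderE -defR.
  by rewrite (card_Hall sylR) -(card_Hall sylP3).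
have memC (c : gT): c \in u ^: P -> [/\ 2.-elt c, c \in 'N_G(P) & c \notin 'C(P)].
  case/imsetP=> d Pd ->; rewrite p_eltJ; split=> //.
    by rewrite groupJ // in_setI (subsetP sPG) // (subsetP (normG P)).
  apply: contra ncu => cPud; rewrite -(conjgK d u).
  by rewrite groupJ // groupV (subsetP (abS P sylP)).
have nt2 (c : gT): c \in u ^: P -> c <> 1.
  by case/memC=> _ _ ncc c1; rewrite c1 group1 in ncc.
have [a b Aa Bb cab|ncAB oAB] := noncommutingU ncA ncB.
  have b3 := memB3 b Bb; suffices b1: b = 1 by rewrite b1 order1 in b3.
  apply: (@p'elt 3) => //; first by rewrite /p_elt b3.
  exact: centA Aa (subsetP sBG b Bb) cab.
have [a c ABa Cc cac|ncABC oABC] := noncommutingU ncAB ncC; last first.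
  have: #|A :|: B :|: u ^: P| <= 20 by apply: leG ncABC; rewrite !subUset sAG sBG.
  by rewrite oABC oAB oA card_S oB oC addnAC leqNgt (leq_add (leqnn 11) gt9).
have [c2 Nc ncc] := memC c Cc; have [Gc nPc] := setIP Nc.
have [Aa | Bb] := setUP ABa.
  by apply: (nt2 c Cc); apply: (@p'elt 2) => //; apply: centA Aa Gc cac.
have Gb := subsetP sBG a Bb; have ob := memB3 a Bb.
have nb: a \notin 'N(P).
  apply: contra_eqN ob => nPb; have: a \in 'N_G(P) by rewrite in_setI Gb.
  move/order_dvdG; rewrite oN => dv; apply: contraTneq dv => ->.
  by case/orP: t24 => /eqP->.
have nb2: a ^+ 2 \notin 'N(P).
  apply: contra nb => nb2; have -> : a = (a ^+ 2) ^+ 2.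
    by rewrite -expgM -[LHS]mulg1 -(expg_order a) ob -expgS.
  exact: groupX.
have neJ x : x \notin 'N(P) -> P :^ x != P by apply: contra => /eqP/normP.
have sylJ x : x \in G -> 5.-Sylow(G) (P :^ x)%G by move=> Gx; rewrite pHallJ.
have cJ x : commute c x -> c \in 'N(P :^ x).
  by move=> cx; rewrite normJ mem_conjg (conjg_fixP _) //; apply/commgP/commuteV.
(* Here [a] has order 3 and commutes with [c], so [c] normalizes the three distinct Sylow subgroups
   [P], [P :^ a] and [P :^ (a ^+ 2)]; [SylS_fix3] then makes [c] centralize [P]. *)
case/negP: ncc.
apply: (SylS_fix3 simG ncG (isT : prime 5) dv5 card_S sylP nPc
  (sylJ a Gb) (sylJ (a ^+ 2) (groupX 2 Gb)) (neJ a nb) (neJ _ nb2)).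
- apply: contra nb; rewrite expgS expg1 /= conjsgM => /eqP eqPa.
  by apply/normP/(@conjsg_inj _ a); rewrite -eqPa.
- exact/cJ/commute_sym.
exact/cJ/commuteX/commute_sym.
Qed.

(** There are 8 Sylow 7-subgroups, and [#|G|] is 168 or 336, as 112 has only two prime factors.
    Elements of order 7 and 3 do not commute, so there are at most 12 Sylow 3-subgroups, hence 7.
    The 7 conjugates under [P] of an element [v] of order 3 normalizing [P] generate all of them. So
    every Sylow 3-subgroup normalizes every Sylow 7-subgroup, against faithfulness. *)
Lemma few_not_dvd7 : ~~ (7 %| #|G|).
Proof.
apply/negP=> dv7; have [//|//|le20 abS] := @few_card_Syl 7 _ _ dv7.
have card_S: #|'Syl_7(G)| = 8.
  have := simple_card_Syl_gt1 simG ncG (isT : prime 7) dv7.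
  have := card_Syl_mod G (isT : prime 7).
  have: #|'Syl_7(G)| != 15.
    apply: contraNneq (few_not_dvd5) => o15.
    by apply: dvdn_trans (card_Syl_dvd 7 G); rewrite o15.
  by move: #|'Syl_7(G)| le20 => n; do 21?[case: n => [|n] //].
have [P sylP] := Sylow_exists 7 G.
have sPG := pHall_sub sylP.
have [t [oN oG dvt t_gt1]] := SylS_norm_card simG ncG (isT : prime 7) dv7 card_S sylP.
have cP R sylR := @SylS_cent _ G 7 R simG ncG isT dv7 card_S sylR.
have oP := @SylS_card _ G 7 P simG ncG isT dv7 card_S sylP.
have t36 : (t == 3) || (t == 6).
  have t_le6 : t <= 6 by apply: dvdn_leq _ dvt.
  case: t {oN} oG t_le6 t_gt1 dvt => [|[|[|[|[|[|[|t]]]]]]] // oG _ _ _.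
  case/negP: (simple_nonabelian_nonsolvable simG ncG).
  by apply: Burnside_p_a_q_b; rewrite oG; vm_compute.
have [dv3 gt24 p3 dvN n3P]:
    [/\ 3 %| #|G|, 24 < #|G|, partn #|G| 3 = 3, 3 %| #|'N_G(P)|
      & ~~ (10 %| #|G|)].
  by rewrite p_part oG oN; case/orP: t36 => /eqP->; split; vm_compute.
have [P3 sylP3] := Sylow_exists 3 G.
have oP3: #|P3| = 3 by rewrite (card_Hall sylP3).
have [A [sAG ncA oA memA]] := Sylow_prime_noncommuting (isT : prime 7) sylP oP.
have [B [sBG ncB oB memB]] := Sylow_prime_noncommuting (isT : prime 3) sylP3 oP3.
have not37 (b : gT) : #[b] = 3 -> ~ 7.-elt b.
  by move=> ob; rewrite /p_elt ob.
have [a b Aa Bb cab|ncAB oAB] := noncommutingU ncA ncB.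
  have [R sylR [defR nta]] := memA a Aa; have [S sylS [defS ntb]] := memB b Bb.
  apply: (not37 b); first by rewrite orderE -defS (card_Hall sylS) -(card_Hall sylP3).
  have: b \in 'C_G(R).
    by rewrite in_setI (subsetP sBG) // defR cent_cycle; apply/cent1P.
  by rewrite cP //; apply: mem_p_elt (pHall_pgroup sylR).
have le12: #|'Syl_3(G)| <= 12.
  have: #|A :|: B| <= 20 by apply: leG ncAB; rewrite subUset sAG.
  by rewrite oAB oA oB card_S.
have n3: #|'Syl_3(G)| = 7.
  have [//|gt9] := simple_card_Syl3 simG ncG dv3 gt24.
  have := card_Syl_mod G (isT : prime 3); have := card_Syl_dvd 3 G.
  move: #|'Syl_3(G)| le12 gt9 => n; do 13?[case: n => [|n] //] => _ _ dv10.
  by case/negP: n3P.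
have [v Nv ov] := Cauchy (isT : prime 3) dvN; have [Gv nPv] := setIP Nv.
have v3: 3.-elt v by rewrite /p_elt ov.
have ncv: v \notin 'C(P).
  apply/negP=> cPv; apply: (not37 v ov); apply: mem_p_elt (pHall_pgroup sylP) _.
  by rewrite -(cP P sylP) in_setI Gv.
have r'P: 3^'.-group P by rewrite /pgroup oP.
have [ncV _] := coprime_class_noncommuting (isT : prime 3) r'P v3 nPv.
have oV: #|v ^: P| = 7.
  have /primeP[_ /(_ #|v ^: P|)] := (isT : prime 7).
  rewrite -{1}oP -index_cent1 dvdn_indexg => /(_ isT)/orP[|/eqP//].
  rewrite indexg_eq1 subsetI subxx sub_cent1 /= => cPv.
  by rewrite cPv in ncv.
have memV (c : gT): c \in v ^: P -> c \in 'N_G(P) /\ #[c] = 3.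
  case/imsetP=> d Pd ->; rewrite orderJ groupJ // in_setI (subsetP sPG) //.
  by rewrite (subsetP (normG P)).
pose f (c : gT) := <[c]>%G.
have injf: {in v ^: P &, injective f}.
  move=> c d Vc Vd eqcd; apply: (noncommutingP _ ncV) => //.
  have /cycleP[i ->]: d \in <[c]> by rewrite -[<[c]>]/(gval (f c)) eqcd cycle_id.
  exact: commuteX.
have eqV: f @: (v ^: P) = 'Syl_3(G).
  apply/eqP; rewrite eqEcard card_in_imset // oV n3 leqnn andbT.
  apply/subsetP=> _ /imsetP[c Vc ->]; have [Nc oc] := memV c Vc.
  rewrite inE pHallE -(card_Hall sylP3) oP3 cycle_subG -orderE oc eqxx andbT.
  by case/setIP: Nc.
have norm3 (S : {group gT}) : 3.-Sylow(G) S -> S \subset 'N(P).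
  move=> sylS; have: S \in 'Syl_3(G) by rewrite inE.
  rewrite -eqV => /imsetP[c Vc ->]; have [/setIP[_ nPc] _] := memV c Vc.
  by rewrite cycle_subG.
suffices v1: v = 1 by rewrite v1 order1 in ov.
apply/set1gP; rewrite -(simple_Syl_faithful simG ncG (isT : prime 7) dv7).
rewrite in_setI Gv /=; apply/astabP=> R; rewrite inE => sylR.
have [g Gg defR] := Sylow_trans sylP sylR.
apply/val_inj/normP; rewrite /= defR normJ mem_conjg.
have sylv: 3.-Sylow(G) <[v ^ g^-1]>%G.
  rewrite pHallE -(card_Hall sylP3) oP3 cycle_subG groupJ ?groupV //=.
  by rewrite -orderE orderJ ov.
by rewrite -cycle_subG; apply: (norm3 _ sylv).
Qed.

Lemma few_noncommuting_not_simple : False.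
Proof.
case/negP: (simple_nonabelian_nonsolvable simG ncG); apply: Burnside_p_a_q_b.
apply: (@uniq_leq_size _ _ [:: 2; 3]); first exact: primes_uniq.
move=> p; rewrite mem_primes => /and3P[p_pr _ p_dv].
have p_le10: p <= 10.
  by rewrite leqNgt; apply: contraL p_dv; apply: few_no_large_prime.
have p5: p != 5 by apply: contraTneq p_dv => ->; apply: few_not_dvd5.
have p7: p != 7 by apply: contraTneq p_dv => ->; apply: few_not_dvd7.
by move: p p_le10 p5 p7 p_pr {p_dv} => p; do 11?[case: p => [|p] //].
Qed.

End FewNoncommuting.

(** * Induction on the order, reducing to simple groups *)

Lemma noncommuting_le_solvable (gT : finGroupType) (G : {group gT}) :
  noncommuting_le 20 G -> solvable G.
Proof.
have [n] := ubnP #|G|; elim: n gT G => // n IHn gT G leGn leG.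
have [abG | ncG] := boolP (abelian G); first exact: abelian_sol.
have ntG: G :!=: 1 by apply: contraNneq ncG => ->; apply: abelian1.
have [/forall_inP simG | ] :=
  boolP [forall (N : {group gT} | N <| G), (N :==: 1) || (N :==: G)].
  case: (few_noncommuting_not_simple _ ncG leG); apply/simpleP; split=> // N nsNG.
  by case/orP: (simG N nsNG) => /eqP; auto.
rewrite negb_forall_in => /exists_inP[N nsNG]; rewrite negb_or => /andP[ntN neNG].
have sNG := normal_sub nsNG.
rewrite (series_sol nsNG); apply/andP; split; apply: IHn.
- by apply: leq_trans (_ : #|G| <= n); rewrite // proper_card // properEneq neNG.
- exact: noncommuting_leS leG.
- by apply: leq_trans (_ : #|G| <= n); rewrite // ltn_quotient.
exact: noncommuting_le_quotient leG.
Qed.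

(** * Centralizers in a simple group of order 60 *)

Section SimpleOrder60.

Variables (gT : finGroupType) (G : {group gT}).
Hypotheses (simG : simple G) (ncG : ~~ abelian G) (oG : #|G| = 60).

Let dv2 : 2 %| #|G|. Proof. by rewrite oG. Qed.
Let dv3 : 3 %| #|G|. Proof. by rewrite oG. Qed.
Let dv5 : 5 %| #|G|. Proof. by rewrite oG. Qed.

Lemma simple60_card_Syl5 : #|'Syl_5(G)| = 6.
Proof.
have gt1 := simple_card_Syl_gt1 simG ncG (isT : prime 5) dv5.
have mod5 := card_Syl_mod G (isT : prime 5); have := card_Syl_dvd 5 G.
rewrite oG dvdn_divisors // => n60; apply/eqP.
have /allP/(_ _ n60): all [pred n | (1 < n) ==> (n %% 5 == 1%N) ==> (n == 6)] (divisors 60).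
  by vm_compute.
by rewrite /= gt1 mod5.
Qed.

Lemma simple60_card_Syl3 : #|'Syl_3(G)| = 10.
Proof.
have mod3 := card_Syl_mod G (isT : prime 3); have := card_Syl_dvd 3 G.
have [|n7|gt9] := simple_card_Syl3 simG ncG dv3; rewrite oG //.
  by rewrite n7.
rewrite dvdn_divisors // => n60; apply/eqP.
have /allP/(_ _ n60): all [pred n | (9 < n) ==> (n %% 3 == 1%N) ==> (n == 10)] (divisors 60).
  by vm_compute.
by rewrite /= gt9 mod3.
Qed.

Let logn60 p : logn p 60 <= 2.
Proof.
have [p60 | ] := boolP (p \in primes 60); last by rewrite -logn_gt0 -leqNgt; case: logn.
have /allP/(_ _ p60)//: all [pred p | logn p 60 <= 2] (primes 60) by vm_compute.
Qed.

Lemma simple60_Sylow_abelian p (P : {group gT}) : p.-Sylow(G) P -> abelian P.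
Proof.
move=> sylP; apply: p2group_abelian (pHall_pgroup sylP) _.
by rewrite (card_Hall sylP) oG logn_part.
Qed.

(** The number divides 15, and is not 15 because by Burnside transfer a Sylow 2-subgroup differs
    from its normalizer. *)
Lemma simple60_card_Syl2 : #|'Syl_2(G)| <= 5.
Proof.
have [S sylS] := Sylow_exists 2 G; have sSG := pHall_sub sylS.
have oS: #|S| = 4 by rewrite (card_Hall sylS) oG p_part; vm_compute.
have abS := simple60_Sylow_abelian sylS.
have := simple_Burnside_transfer simG ncG (isT : prime 2) dv2 sylS abS.
have sSN: S \subset 'N_G(S) by rewrite subsetI sSG normG.
move=> ncN; have: 1 < #|'N_G(S) : S|.
  rewrite indexg_gt1; apply: contra ncN => sNS; exact: subset_trans sNS abS.
have := Lagrange sSN; have := Lagrange (subsetIl G 'N(S)).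
have := card_Syl_mod G (isT : prime 2); rewrite (card_Syl sylS) oG oS.
move: #|_ : 'N_G(S)| #|'N_G(S)| #|_ : S| => n m j _ nj jm j_gt1; rewrite -jm in nj.
have {}nj : (j * n = 15)%N by apply/eqP; rewrite -(eqn_pmul2l (isT : 0 < 4)) mulnA nj.
rewrite leqNgt; apply/negP; move: nj j_gt1; clear.
by case: j => [|[|[|j]]]; nia.
Qed.

(** A subgroup of order 5 is its own centralizer, which leaves orders 3 and 2. On the 6 Sylow
    5-subgroups, whose normalizers have order 10, [y] of order 3 fixes nothing. So the number fixed
    by an involution commuting with [y] is a multiple of 3, while the number moved is a positive
    multiple of 4, and these cannot sum to 6. *)
Lemma simple60_noncommuting_primes (y z : gT) p q :
    y \in G -> z \in G -> prime p -> prime q -> p != q -> #[y] = p -> #[z] = q ->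
  ~ commute y z.
Proof.
wlog ltqp: y z p q / q < p.
  move=> IH Gy Gz pp pq npq oy oz cyz.
  have [lt|lt|eq] := ltngtP q p; first exact: (IH y z p q).
    by apply: (IH z y q p) => //; rewrite eq_sym.
  by rewrite eq eqxx in npq.
move=> Gy Gz p_pr q_pr npq oy oz cyz.
have card5 := simple60_card_Syl5.
have dvp : p %| 60 by rewrite -oG -oy order_dvdG.
have dvq : q %| 60 by rewrite -oG -oz order_dvdG.
have faith := simple_Syl_faithful simG ncG (isT : prime 5) dv5.
have mem235 r : prime r -> r %| 60 -> r \in [:: 2; 3; 5].
  by move=> r_pr r60; rewrite -[_ :: _]/(primes 60) mem_primes r_pr.
have sylX (x : gT) r : x \in G -> #[x] = r -> r \in [:: 3; 5] -> r.-Sylow(G) <[x]>%G.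
  move=> Gx ox r35; rewrite pHallE cycle_subG Gx -[#|_|]/(#[x]) ox p_part oG /=.
  by move: r35; rewrite !inE => /orP[]/eqP->; vm_compute.
have p35: p \in [:: 3; 5].
  have := mem235 p p_pr dvp; rewrite !inE => /orP[/eqP p2|//]; rewrite p2 in ltqp.
  by case: q ltqp q_pr {npq oz dvq} => [|[|]].
have sylP := sylX y p Gy oy p35; rewrite !inE in p35; case/orP: p35 => /eqP p35; last first.
  have: z \in 'C_G(<[y]>) by rewrite in_setI Gz cent_cycle; apply/cent1P/commute_sym.
  rewrite p35 in sylP.
  rewrite (SylS_cent simG ncG (isT : prime 5) dv5 card5 sylP) => /order_dvdG.
  rewrite oz -orderE oy p35 dvdn_prime2 // => /eqP q5.
  by rewrite q5 p35 eqxx in npq.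
have q2: q = 2 by move: ltqp q_pr; rewrite p35; case: q {npq oz dvq} => [|[|[|]]].
have y3: 3.-group <[y]> by rewrite -p35; apply: pHall_pgroup sylP.
have w2: z ^+ 2 = 1 by rewrite -q2 -oz expg_order.
have := simple_action_even simG ncG (acts_Syl G 5) Gz w2.
have := cardsID 'Fix_'JG[z] 'Syl_5(G); rewrite card5.
set D := _ :\: _; set F := _ :&: _.
have actF: [acts <[y]>, on F | 'JG].
  apply: actsI; first by apply: subset_trans _ (acts_Syl G 5); rewrite cycle_subG.
  by apply: acts_fix_norm; rewrite cycle_subG; apply/cent1P.
have := pgroup_fix_mod y3 actF.
have ->: 'Fix_(F | 'JG)(<[y]>) = set0.
  apply/eqP/set0Pn=> [[R /setIP[/setIP[SR _]]]]; rewrite inE in SR.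
  rewrite afixJG cycle_subG => nRy.
  have: y \in 'N_G(R) by rewrite in_setI Gy.
  move/order_dvdG; rewrite oy p35.
  have := Lagrange (subsetIl G 'N(R)); rewrite -(card_Syl SR) card5 oG.
  move: #|_| => n n6; have ->: n = 10 by apply/eqP; rewrite -(eqn_pmul2r (isT : 0 < 6)) n6.
  by [].
have: D != set0.
  apply/eqP=> /eqP; rewrite setD_eq0 => sSz.
  have: z \in 'C_G('Syl_5(G) | 'JG) by rewrite in_setI Gz /= -sub1set astabC.
  by rewrite faith => /set1gP z1; rewrite z1 order1 in oz; rewrite -oz in q_pr.
rewrite cards0 -card_gt0; move: #|F| #|D| => m n; clear; lia.
Qed.

(** A power [y] of [x] has prime order [p]; every element of prime order in ['C_G[x]] commutes with
    [y], so has order [p]. Thus ['C_G[x]] is a p-group, and it contains the abelian Sylow subgroup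
    around it. *)
Lemma simple60_centralizer_Sylow x :
  x \in G^# -> exists2 p, prime p && (p %| 60) & p.-Sylow(G) 'C_G[x].
Proof.
move=> /setD1P[ntx Gx]; pose p := pdiv #[x].
have p_pr: prime p by rewrite pdiv_prime // order_gt1.
have [y xy oy] := Cauchy p_pr (pdiv_dvd #[x] : p %| #|<[x]>|).
have Gy: y \in G by apply: subsetP xy; rewrite cycle_subG.
exists p; first by rewrite p_pr -oG -oy order_dvdG.
have pC: p.-group 'C_G[x].
  apply/pgroupP=> q q_pr dvq; have [z /setIP[Gz cxz] oz] := Cauchy q_pr dvq.
  rewrite inE; apply: contraT => nqp; case: (@simple60_noncommuting_primes z y q p) => //.
  by have /cycleP[i ->] := xy; apply: commuteX; apply: commute_sym; apply/cent1P; rewrite cent1C.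
have [P sylP sCP] := Sylow_superset (subsetIl G 'C[x]) pC.
suffices ->: 'C_G[x] = P by [].
apply/eqP; rewrite eqEsubset sCP subsetI (pHall_sub sylP) sub_cent1 /=.
apply: (subsetP (simple60_Sylow_abelian sylP)); apply: (subsetP sCP).
by rewrite in_setI Gx cent1id.
Qed.

Lemma simple60_card_centralizers : #|centralizers G| <= 22.
Proof.
pose T p : {set {set gT}} := [set gval P | P in 'Syl_p(G)].
have sC: centralizers G \subset [set gval G] :|: (T 5 :|: (T 3 :|: T 2)).
  apply/subsetP=> _ /imsetP[x Gx ->]; rewrite !in_setU in_set1.
  have [-> | ntx] := eqVneq x 1; first by rewrite cent11T setIT eqxx.
  have [|p /andP[p_pr p60] sylC] := @simple60_centralizer_Sylow x; first by rewrite in_setD1 ntx.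
  have TC: 'C_G[x] \in T p by apply/imsetP; exists 'C_G[x]%G; rewrite ?inE.
  have: p \in primes 60 by rewrite mem_primes p_pr.
  by rewrite !inE => /or3P[]/eqP p_eq; rewrite p_eq in TC; rewrite TC ?orbT.
have le n (A B : {set {set gT}}) m : #|A| <= n -> #|B| <= m -> #|A :|: B| <= n + m.
  by move=> lA lB; rewrite (leq_trans (leq_card_setU A B)) ?leq_add.
apply: leq_trans (subset_leq_card sC) _.
have leT p := leq_imset_card (@gval gT) 'Syl_p(G).
have le2 := le 10 _ _ 5 (_ : #|T 3| <= 10) (leq_trans (leT 2) simple60_card_Syl2).
(* The count is 22 = 1 + 6 + 10 + 5: [G] itself and the Sylow subgroups for 5, 3 and 2. *)
apply: (le 1%N _ _ 21 _ (le 6 _ _ 15 _ (le2 _))); first by rewrite cards1.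
  by rewrite -simple60_card_Syl5 leT.
by rewrite -simple60_card_Syl3 leT.
Qed.

End SimpleOrder60.

Theorem theoremA :
  (forall (gT : finGroupType) (G : {group gT}),
      #|centralizers G| <= 21 -> solvable G) /\
  #|centralizers ('Alt_('I_5))| = 22.
Proof.
have sol (gT : finGroupType) (G : {group gT}) : #|centralizers G| <= 21 -> solvable G.
  by move/(@centralizers_noncommuting_le _ 20 G isT)/noncommuting_le_solvable.
split=> //; have nsolA: ~~ solvable 'Alt_('I_5) by rewrite solvable_AltF ?card_ord.
(* The lower bound is the contrapositive of the first half, as the alternating group of degree 5 is
   not solvable. *)
apply/eqP; rewrite eqn_leq andbC ltnNge (contra (sol _ _) nsolA) /=.
apply: simple60_card_centralizers.
- by apply: simple_Alt5; rewrite card_ord.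
- by apply: contra nsolA; apply: abelian_sol.
by apply/eqP; rewrite -(eqn_pmul2l (isT : 0 < 2)) card_Alt card_ord.
Qed.
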